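(* Let $v$ be a Krull valuation of arbitrary rank on a field $\mathbb{K}$, with value group $G_v=v(\mathbb{K}^\times)$. Let $f=a_0+a_1 z+\cdots+a_n z^n \in \mathbb{K}[z]$ be a polynomial of degree $n$. Suppose there exist smallest indices $j$ and $k$ with $1\leq k+1\leq j\leq n$ for which the following conditions are satisfied: (i) $v(a_j)=0$; (ii) $\frac{v(a_k)}{j-k}<\frac{v(a_i)}{j-i}$ for all indices $i$ with $0\leq i\leq j-1$ and $i\neq k$; (iii) if $j<n$, then $\frac{v(a_k)}{j-k}>\frac{v(a_i)}{j-i}$ for all indices $i$ with $j+1\leq i\leq n$; (iv) $v(a_k)\notin dG_v$ for any positive divisor $d>1$ of $j-k$. Then any factorization $f(z)=f_1(z)f_2(z)$ of $f$ in $\mathbb{K}[z]$ has a factor of degree $\leq n-j+k$. In particular, if $j=n$ and $k=0$, then $f$ is irreducible in $\mathbb{K}[z]$.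
   Context: A Krull valuation on $\mathbb{K}$ is a surjective map $v:\mathbb{K}\to G_v\cup\{\infty\}$, where $G_v$ is a totally ordered abelian group, such that $v(x)=\infty$ iff $x=0$, $v(xy)=v(x)+v(y)$, and $v(x+y)\geq\min\{v(x),v(y)\}$; here $\infty$ exceeds every element and absorbs addition. Quotients such as $\frac{v(a_i)}{m}$ (for a positive or negative integer $m$) are taken in a totally ordered abelian group containing $G_v$ in which such divisions are possible (e.g. the divisible hull $G_v\otimes\mathbb{Q}$ with its induced order), with the convention $\infty/m=\infty$. For a positive integer $d$, $dG_v=\{dg: g\in G_v\}$. *)

(* Defs.v *)
From HB Require Import structures.
From mathcomp Require Import all_boot all_order all_algebra.

Set Implicit Arguments.
Unset Strict Implicit.
Unset Printing Implicit Defensive.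

Import Order.TTheory GRing.Theory Num.Theory.
Local Open Scope ring_scope.

(* Totally ordered abelian groups, written additively; no archimedean or
   discreteness condition, so every rank is allowed. Totality is a field rather
   than an inheritance from Order.Total, because that join with zmodType clashes
   with realDomainType in the hierarchy. *)
HB.mixin Record POrderedZmodule_isTotallyOrderedGroup G
    of Num.POrderedZmodule G := {
  leg_total : total (fun x y : G => x <= y);
  leg_translate : forall x y z : G, x <= y -> x + z <= y + z
}.

#[short(type="orderedZmodType")]
HB.structure Definition OrderedZmodule :=
  { G of Num.POrderedZmodule G & POrderedZmodule_isTotallyOrderedGroup G }.

(* A totally ordered group is torsion-free, so for m != 0 the equation below
   determines [divg x m]; its value at m = 0 is irrelevant. *)
HB.mixin Record Zmodule_isDivisible H of GRing.Zmodule H := {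
  divg : H -> int -> H;
  divgK : forall (x : H) (m : int), m != 0 -> divg x m *~ m = x
}.

#[short(type="divOrderedZmodType")]
HB.structure Definition DivOrderedZmodule :=
  { H of OrderedZmodule H & Zmodule_isDivisible H }.

(* [option G] stands for the disjoint union of G and {oo}: [None] is oo. *)
Section Infinity.
Context {G : orderedZmodType}.
Implicit Types x y : option G.

Definition addo x y : option G :=
  if x is Some a then if y is Some b then Some (a + b) else None else None.

Definition leo x y : bool :=
  if y is Some b then if x is Some a then a <= b else false else true.

Definition lto x y : bool := ~~ leo y x.

Definition mino x y : option G := if leo x y then x else y.

End Infinity.

Record krull_valuation (K : fieldType) (G : orderedZmodType)
    (v : K -> option G) : Prop := KrullValuation {
  krull_surj : forall w : option G, exists x : K, v x = w;
  krull_infty : forall x : K, v x = None <-> x = 0;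
  krull_mul : forall x y : K, v (x * y) = addo (v x) (v y);
  krull_add : forall x y : K, leo (mino (v x) (v y)) (v (x + y))
}.

(* w / m computed in H, with oo / m = oo whatever the sign of m. *)
Definition quo (G : orderedZmodType) (H : divOrderedZmodType) (iota : G -> H)
    (w : option G) (m : int) : option H :=
  omap (fun g => divg (iota g) m) w.

(* The denominator j - i is an integer, negative when j < i. *)
Definition slope (K : fieldType) (G : orderedZmodType) (H : divOrderedZmodType)
    (iota : G -> H) (v : K -> option G) (f : {poly K}) (j i : nat) : option H :=
  quo iota (v f`_i) (j%:Z - i%:Z).

Record slope_conditions (K : fieldType) (G : orderedZmodType)
    (H : divOrderedZmodType) (iota : G -> H) (v : K -> option G)
    (f : {poly K}) (n j k : nat) : Prop := SlopeConditions {
  slope_range : (1 <= k + 1 <= j)%N && (j <= n)%N;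
  slope_unit : v f`_j = Some 0;
  slope_left : forall i : nat, (i <= j - 1)%N -> i != k ->
    lto (slope iota v f j k) (slope iota v f j i);
  slope_right : (j < n)%N -> forall i : nat, (j + 1 <= i <= n)%N ->
    lto (slope iota v f j i) (slope iota v f j k);
  slope_indivisible : forall d : nat, (1 < d)%N -> (d %| j - k)%N ->
    ~ exists g : G, v f`_k = Some (g *+ d)
}.

(* "Smallest" is taken in the order that compares j first and then k; this
   minimum exists as soon as some pair satisfies the conditions. *)
Definition smallest_indices (P : nat -> nat -> Prop) (j k : nat) : Prop :=
  P j k /\ forall j' k' : nat, P j' k' ->
    (j < j')%N \/ j = j' /\ (k <= k')%N.

(* Main.v *)
(* Let la be the slope v(a_k) / (j - k). By (i)-(iii) the points (i, v(a_i))
   with i <> k, j lie strictly above the line through (k, v(a_k)) and (j, 0), so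
   the Gauss valuation min_i (v(a_i) + i la) of f is attained exactly at k and j.
   The first and the last index attaining the Gauss valuation are additive over
   products, hence k = s1 + s2 and j = t1 + t2, where [si, ti] is the range of
   minimal indices of fi. Comparing the values at s1 and t1 gives
   (t1 - s1) la \in G_v, and (iv) says that j - k is the order of la modulo G_v;
   so t1 - s1 is 0 or j - k, and one factor has degree at least j - k. *)

Require Import Defs.
From HB Require Import structures.
From mathcomp Require Import all_boot all_order all_algebra.

Set Implicit Arguments.
Unset Strict Implicit.
Unset Printing Implicit Defensive.

Import Order.TTheory GRing.Theory Num.Theory.
Local Open Scope ring_scope.

(** * Totally ordered abelian groups, and their order extended by infinity *)

Section OrderedGroups.
Variable G : orderedZmodType.
Implicit Types (x y z : G) (n : nat).

Lemma leg_add2r z x y : (x + z <= y + z) = (x <= y).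
Proof.
apply/idP/idP => [le_xz|]; last exact: leg_translate.
by have := leg_translate _ _ (- z) le_xz; rewrite !addrK.
Qed.

Lemma ltgNge x y : (x < y) = ~~ (y <= x).
Proof.
rewrite lt_neqAle; have [le_yx|] := boolP (y <= x).
  by rewrite eq_le le_yx andbT andNb.
by have /orP[->|-> //] := leg_total x y; rewrite andbT; apply: contra => /eqP->.
Qed.

Lemma ltg_add2r z x y : (x + z < y + z) = (x < y).
Proof. by rewrite !ltgNge leg_add2r. Qed.

Lemma ltg_add2l z x y : (z + x < z + y) = (x < y).
Proof. by rewrite ![z + _]addrC ltg_add2r. Qed.

Lemma ltg_addMn n x y : x < y -> x *+ n.+1 < y *+ n.+1.
Proof.
move=> lt_xy; elim: n => // n IHn; rewrite !(mulrS _ n.+1).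
by apply: (@lt_trans _ _ (y + x *+ n.+1)); rewrite ?ltg_add2r ?ltg_add2l.
Qed.

(** Ordered groups are torsion-free because positive multiples keep a strict sign; this is what pins
    down the value of -1 under a valuation. *)
Lemma mulgn_eq0 n x : x *+ n.+1 = 0 -> x = 0.
Proof.
move=> xn0; apply/eqP/negPn/negP => x_neq0.
have [lt_x0|] := boolP (x < 0).
  by have := ltg_addMn n lt_x0; rewrite xn0 mul0rn ltxx.
rewrite ltgNge negbK => le_0x.
have lt_0x : 0 < x by rewrite lt_neqAle eq_sym x_neq0.
by have := ltg_addMn n lt_0x; rewrite xn0 mul0rn ltxx.
Qed.

Implicit Types o p q : option G.

Lemma leo_trans q o p : leo o q -> leo q p -> leo o p.
Proof. by case: o p q => [x|] [y|] [z|] //=; apply: le_trans. Qed.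

Lemma leo_total o p : leo o p || leo p o.
Proof. by case: o p => [x|] [y|] //=; apply: leg_total. Qed.

Lemma leo_anti o p : leo o p -> leo p o -> o = p.
Proof.
case: o p => [x|] [y|] //= le_xy le_yx.
by congr Some; apply/eqP; rewrite eq_le le_xy.
Qed.

Lemma ltoW o p : lto o p -> leo o p.
Proof. by rewrite /lto; have /orP[->|->] := leo_total o p. Qed.

Lemma lto_leo_trans q o p : lto o q -> leo q p -> lto o p.
Proof. by move=> lt_oq le_qp; apply: contra lt_oq; apply: leo_trans. Qed.

Lemma leo_addo c d o p :
  leo (Some c) o -> leo (Some d) p -> leo (Some (c + d)) (addo o p).
Proof.
case: o p => [x|] [y|] //= le_cx le_dy.
by apply: (@le_trans _ _ (x + d)); rewrite ?leg_add2r // ![x + _]addrC leg_add2r.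
Qed.

Lemma lto_addol c d o p :
  lto (Some c) o -> leo (Some d) p -> lto (Some (c + d)) (addo o p).
Proof.
rewrite /lto; case: o p => [x|] [y|] //=; rewrite -!ltgNge => lt_cx le_dy.
by apply: (@lt_le_trans _ _ (x + d)); rewrite ?ltg_add2r // ![x + _]addrC leg_add2r.
Qed.

Lemma addoC o p : addo o p = addo p o.
Proof. by case: o p => [x|] [y|] //=; rewrite addrC. Qed.

Lemma lto_addor c d o p :
  leo (Some c) o -> lto (Some d) p -> lto (Some (c + d)) (addo o p).
Proof. by move=> *; rewrite addrC addoC; apply: lto_addol. Qed.

End OrderedGroups.

(** * Elementary properties of Krull valuations *)

Section Valuation.
Variables (K : fieldType) (G : orderedZmodType) (v : K -> option G).
Hypothesis hv : krull_valuation v.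

Lemma krull0 : v 0 = None.
Proof. exact/(krull_infty hv). Qed.

Lemma krull_neq0 x : x != 0 -> exists g, v x = Some g.
Proof.
by case E: (v x) => [g|]; [exists g | move/(krull_infty hv): E => ->; rewrite eqxx].
Qed.

Lemma krull1 : v 1 = Some 0.
Proof.
have [g vg] := krull_neq0 (oner_neq0 K).
have := krull_mul hv 1 1; rewrite mulr1 vg /= => -[/eqP].
by rewrite -subr_eq subrr eq_sym => /eqP ->.
Qed.

(** Since (-1)(-1) = 1, the value of -1 is killed by 2, hence is zero in a torsion-free group. *)
Lemma krullN x : v (- x) = v x.
Proof.
have [g vg] : exists g, v (-1) = Some g by apply: krull_neq0; rewrite oppr_eq0 oner_eq0.
have g0 : g = 0.
  apply: (@mulgn_eq0 _ 1); have := krull_mul hv (-1) (-1).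
  by rewrite mulrNN mulr1 krull1 vg /= mulr2n => -[].
rewrite -mulN1r (krull_mul hv) vg g0.
by case: (v x) => //= y; rewrite add0r.
Qed.

(** * The Gauss valuation with weight [la] on the variable *)

Variables (H : orderedZmodType) (iota : {additive G -> H}).
Hypothesis iota_mono : {mono iota : x y / x <= y}.
Variable la : H.

(* The value of the monomial [x 'X^i] when 'X is given the value [la]. *)
Definition monval (i : nat) (x : K) : option H :=
  omap (fun g => iota g + la *+ i) (v x).

Lemma monval0 i : monval i 0 = None.
Proof. by rewrite /monval krull0. Qed.

Lemma monvalM i l x y : monval (i + l) (x * y) = addo (monval i x) (monval l y).
Proof.
rewrite /monval (krull_mul hv); case: (v x) (v y) => [g|] [h|] //=.
by rewrite raddfD mulrnDr addrACA.
Qed.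

Lemma monvalN i x : monval i (- x) = monval i x.
Proof. by rewrite /monval krullN. Qed.

Lemma leo_monval i x y : leo (monval i x) (monval i y) = leo (v x) (v y).
Proof.
by rewrite /monval; case: (v x) (v y) => [g|] [h|] //=; rewrite leg_add2r iota_mono.
Qed.

(** Both [leo c] and [lto c] are upward closed, so weak and strict lower bounds on sums are handled
    by one argument. *)
Definition upward (P : pred (option H)) := forall o p, P o -> leo o p -> P p.

Lemma upward_leo c : upward (leo c).
Proof. by move=> o p; apply: leo_trans. Qed.

Lemma upward_lto c : upward (lto c).
Proof. by move=> o p; apply: lto_leo_trans. Qed.

Lemma monvalD (P : pred (option H)) i x y : upward P ->
  P (monval i x) -> P (monval i y) -> P (monval i (x + y)).
Proof.
move=> upP Px Py; have := krull_add hv x y; rewrite /mino.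
by case: ifP => _ le_xy; [apply: upP Px _ | apply: upP Py _]; rewrite leo_monval.
Qed.

Lemma monval_sum (P : pred (option H)) (I : finType) (Q : pred I) (F : I -> K) i :
  upward P -> P None -> (forall a, Q a -> P (monval i (F a))) ->
  P (monval i (\sum_(a | Q a) F a)).
Proof.
move=> upP P0 PF; apply: (big_ind (fun x => P (monval i x))) => //.
  by rewrite monval0.
by move=> x y; apply: monvalD.
Qed.

(** If [x + y] had value above [c], then so would [x = (x + y) - y]. *)
Lemma monvalD_lt i x y c :
  monval i x = Some c -> lto (Some c) (monval i y) -> monval i (x + y) = Some c.
Proof.
move=> xc lt_cy; apply: leo_anti; last first.
  apply: monvalD; [exact: upward_leo | by rewrite xc /= | exact: ltoW].
apply/negPn/negP => lt_cxy.
have : lto (Some c) (monval i (x + y - y)).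
  by apply: monvalD; [exact: upward_lto | | rewrite monvalN].
by rewrite addrK xc /lto /= lexx.
Qed.

(* [c] is the Gauss value of [g], attained first at [s] and last at [t]. *)
Record gauss_range (g : {poly K}) (c : H) (s t : nat) : Prop := GaussRange {
  gauss_min : forall i, leo (Some c) (monval i g`_i);
  gauss_first : monval s g`_s = Some c;
  gauss_last : monval t g`_t = Some c;
  gauss_before : forall i, (i < s)%N -> lto (Some c) (monval i g`_i);
  gauss_after : forall i, (t < i)%N -> lto (Some c) (monval i g`_i) }.

Lemma gauss_range_le g c s t : gauss_range g c s t -> (s <= t)%N.
Proof.
case=> _ _ tc lt_c _; rewrite leqNgt; apply/negP => /lt_c.
by rewrite tc /lto /= lexx.
Qed.

Lemma gauss_range_size g c s t : gauss_range g c s t -> (t < size g)%N.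
Proof.
case=> _ _ tc _ _; rewrite ltnNge; apply/negP => le_gt.
by move: tc; rewrite nth_default // monval0.
Qed.

Lemma seq_min_attained (u : nat -> option H) n :
  (forall i, (i < n)%N -> u i = None) \/
  exists c, (exists i, u i = Some c) /\ forall i, (i < n)%N -> leo (Some c) (u i).
Proof.
elim: n => [|n [uN|[c [[p up] c_min]]]]; first by left.
  case En: (u n) => [c|].
    right; exists c; split; first by exists n.
    by move=> i; rewrite ltnS leq_eqVlt => /orP[/eqP->|/uN->] //; rewrite En /=.
  by left=> i; rewrite ltnS leq_eqVlt => /orP[/eqP->|/uN].
right; have /orP[le_cn|] := leo_total (Some c) (u n).
  exists c; split; first by exists p.
  by move=> i; rewrite ltnS leq_eqVlt => /orP[/eqP->|/c_min].
case En: (u n) => [d|] // le_dc; exists d; split; first by exists n.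
move=> i; rewrite ltnS leq_eqVlt => /orP[/eqP->|/c_min]; first by rewrite En /=.
exact: leo_trans.
Qed.

(** The leading coefficient has finite value, so the minimum is finite. Coefficients beyond the size
    have value infinity, so the indices attaining it are bounded and have a least and a greatest
    element. *)
Lemma gauss_range_exists (g : {poly K}) : g != 0 -> exists c s t, gauss_range g c s t.
Proof.
move=> g0; have [gN|[c [[p pc] c_min]]] :=
  seq_min_attained (fun i => monval i g`_i) (size g).
  have [h vh] : exists h, v (lead_coef g) = Some h.
    by apply: krull_neq0; rewrite lead_coef_eq0.
  have := gN (size g).-1; rewrite prednK ?size_poly_gt0 // => /(_ (leqnn _)).
  by rewrite -lead_coefE /monval vh.
have {}c_min i : leo (Some c) (monval i g`_i).
  have [/c_min //|le_gi] := ltnP i (size g).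
  by rewrite nth_default // monval0.
have neq_lt i : monval i g`_i != Some c -> lto (Some c) (monval i g`_i).
  by apply: contraNN => le_ic; apply/eqP/leo_anti.
pose A i := monval i g`_i == Some c.
have exA : exists i, A i by exists p; apply/eqP.
have ubA i : A i -> (i <= size g)%N.
  move/eqP=> ic; rewrite leqNgt; apply/negP => /ltnW le_gi.
  by move: ic; rewrite nth_default // monval0.
exists c, (ex_minn exA), (ex_maxn exA ubA).
case: ex_minnP => s /eqP sc s_min; case: ex_maxnP => t /eqP tc t_max.
split=> // i lt_i; apply: neq_lt; apply: contraTN lt_i; rewrite -leqNgt.
  exact: s_min.
exact: t_max.
Qed.

(** * Gauss ranges of products *)

Lemma monval_coefM (P : pred (option H)) (g h : {poly K}) i : upward P -> P None ->
  (forall a b, (a + b)%N = i -> P (addo (monval a g`_a) (monval b h`_b))) ->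
  P (monval i (g * h)`_i).
Proof.
move=> upP P0 PM; rewrite coefM; apply: monval_sum => // -[a /= lt_ai] _.
have ai : (a + (i - a))%N = i by rewrite subnKC.
by rewrite -{1}ai monvalM; apply: PM.
Qed.

(** A single term of the convolution sum has value exactly [c + d] and the others lie strictly
    above, so no cancellation can raise the value. *)
Lemma monval_coefM_eq (g h : {poly K}) p q c d :
  monval p g`_p = Some c -> monval q h`_q = Some d ->
  (forall a b, (a + b = p + q)%N -> a != p ->
     lto (Some (c + d)) (addo (monval a g`_a) (monval b h`_b))) ->
  monval (p + q) (g * h)`_(p + q) = Some (c + d).
Proof.
move=> pc qd lt_cd; have lt_p : (p < (p + q).+1)%N by rewrite ltnS leq_addr.
rewrite coefM (bigD1 (Ordinal lt_p)) //=; apply: monvalD_lt.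
  by rewrite addKn monvalM pc qd.
apply: monval_sum => //; first exact: upward_lto.
move=> [a /= lt_a] neq_ap.
have aE : (a + (p + q - a))%N = (p + q)%N by rewrite subnKC.
by rewrite -[X in monval X]aE monvalM; apply: lt_cd.
Qed.

(** As in Gauss's lemma: if a + b = s + s' and (a, b) differs from (s, s'), then a < s or b < s', so
    that term lies strictly above [c + d]. For a + b < s + s' this holds of every pair. The last
    indices are treated symmetrically. *)
Lemma gauss_rangeM (g h : {poly K}) c d s t s' t' :
  gauss_range g c s t -> gauss_range h d s' t' ->
  gauss_range (g * h) (c + d) (s + s') (t + t').
Proof.
move=> [g_min gs gt g_lt g_gt] [h_min hs ht h_lt h_gt].
split=> [i|||i lt_i|i lt_i].
- by apply: monval_coefM => //; [exact: upward_leo | move=> *; apply: leo_addo].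
- apply: monval_coefM_eq => // a b ab; rewrite neq_ltn => /orP[lt_a|gt_a].
    by apply: lto_addol => //; apply: g_lt.
  apply: lto_addor => //; apply: h_lt.
  by rewrite -(ltn_add2l s) -ab ltn_add2r.
- apply: monval_coefM_eq => // a b ab; rewrite neq_ltn => /orP[lt_a|gt_a].
    apply: lto_addor => //; apply: h_gt.
    by rewrite -(ltn_add2l t) -ab ltn_add2r.
  by apply: lto_addol => //; apply: g_gt.
- apply: monval_coefM => //; first exact: upward_lto.
  move=> a b ab; have [lt_a|le_a] := ltnP a s.
    by apply: lto_addol => //; apply: g_lt.
  apply: lto_addor => //; apply: h_lt; rewrite -(ltn_add2l s).
  by apply: leq_ltn_trans lt_i; rewrite -ab leq_add2r.
apply: monval_coefM => //; first exact: upward_lto.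
move=> a b ab; have [lt_a|le_a] := ltnP t a.
  by apply: lto_addol => //; apply: g_gt.
apply: lto_addor => //; apply: h_gt; rewrite -(ltn_add2l t).
by apply: leq_trans lt_i _; rewrite -ab leq_add2r.
Qed.

Lemma gauss_range_uniq g c d s t s' t' :
  gauss_range g c s t -> gauss_range g d s' t' -> s = s' /\ t = t'.
Proof.
move=> R R'.
have [cd] : Some c = Some d.
  apply: leo_anti; first by rewrite -(gauss_first R'); apply: gauss_min R _.
  by rewrite -(gauss_first R); apply: gauss_min R' _.
rewrite -{d}cd in R'; split; apply/eqP; rewrite eqn_leq; apply/andP; split;
  rewrite leqNgt; apply/negP.
- by move/(gauss_before R); rewrite (gauss_first R') /lto /= lexx.
- by move/(gauss_before R'); rewrite (gauss_first R) /lto /= lexx.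
- by move/(gauss_after R'); rewrite (gauss_last R) /lto /= lexx.
- by move/(gauss_after R); rewrite (gauss_last R') /lto /= lexx.
Qed.

(** * Multiples of [la] lying in the value group, and degrees of factors *)

Lemma gauss_range_lattice g c s t : gauss_range g c s t ->
  exists x, la *+ (t - s) = iota x.
Proof.
move=> R; have le_st := gauss_range_le R.
move: (gauss_first R) (gauss_last R); rewrite /monval.
case: (v g`_s) (v g`_t) => [x|] [y|] //= [xc] [yc]; exists (x - y).
(* Both ends attain [c], so [iota x + la *+ s = iota y + la *+ t]. *)
by rewrite mulrnBr // raddfB; apply/eqP; rewrite subr_eq addrAC eq_sym subr_eq xc addrC yc.
Qed.

(** The integers multiplying [la] into the value group form a subgroup containing m and e, hence
    gcd(m, e). So [w] is divisible by m / gcd(m, e), which must then be 1; thus m divides e. *)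
Lemma primitive_slope m e w : (0 < m)%N ->
  la *+ m = iota w -> (exists x, la *+ e = iota x) -> (e <= m)%N ->
  (forall d, (1 < d)%N -> (d %| m)%N -> ~ exists x, w = x *+ d) ->
  e = 0%N \/ e = m.
Proof.
move=> m_gt0 mw [x ex] le_em prim; case: (posnP e) => [|e_gt0]; [by left | right].
have iota_inj : injective iota.
  by move=> a b ab; apply/eqP; rewrite eq_le -!iota_mono ab lexx.
(* Bezout with natural coefficients: [gcdn m e + a * e = q * m], so [y] below has image
   [la *+ gcdn m e]. *)
have [a _ /dvdnP[q qE]] := Bezoutl e m_gt0.
pose y := w *+ q - x *+ a.
have gy : la *+ gcdn m e = iota y.
  rewrite raddfB !raddfMn /= -mw -ex mulNrn -!mulrnA [(m * q)%N]mulnC -qE mulrnDr.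
  by rewrite [(a * e)%N]mulnC addrK.
have dvd_m := dvdn_gcdl m e; pose d := (m %/ gcdn m e)%N.
have dE : (gcdn m e * d)%N = m by rewrite mulnC divnK.
have d_gt0 : (0 < d)%N by move: m_gt0; rewrite -dE muln_gt0 => /andP[].
have [d_gt1|] := ltnP 1 d.
  case: (prim d d_gt1); first by rewrite -dE dvdn_mull.
  by exists y; apply: iota_inj; rewrite raddfMn /= -gy -mulrnA dE mw.
move=> d_le1; have d1 : d = 1%N by apply/eqP; rewrite eqn_leq d_le1.
apply/eqP; rewrite eqn_leq le_em /= dvdn_leq //.
by rewrite -dE d1 muln1 dvdn_gcdr.
Qed.

(** The widths of the two Gauss ranges add up to [j - k], and each is 0 or [j - k]; a factor is at
    least as long as its range, because its last minimal index lies below its size. *)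
Lemma factor_degree f c k j w f1 f2 : (k < j)%N -> gauss_range f c k j ->
  la *+ (j - k) = iota w ->
  (forall d, (1 < d)%N -> (d %| j - k)%N -> ~ exists x, w = x *+ d) ->
  f = f1 * f2 -> (j - k < size f1)%N \/ (j - k < size f2)%N.
Proof.
move=> lt_kj Rf wE prim fE.
have f0 : f != 0.
  by rewrite -size_poly_gt0; apply: leq_trans (gauss_range_size Rf).
move: f0; rewrite fE mulf_eq0 negb_or => /andP[f10 f20].
have [c1 [s1 [t1 R1]]] := gauss_range_exists f10.
have [c2 [s2 [t2 R2]]] := gauss_range_exists f20.
have R12 := gauss_rangeM R1 R2; rewrite -fE in R12.
have [kE jE] := gauss_range_uniq Rf R12.
have [le1 le2] := (gauss_range_le R1, gauss_range_le R2).
have jkE : (j - k = (t1 - s1) + (t2 - s2))%N by rewrite jE kE subnDA -addnBAC // -addnBA.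
have m_gt0 : (0 < j - k)%N by rewrite subn_gt0.
have le_e : (t1 - s1 <= j - k)%N by rewrite jkE leq_addr.
have [e0|em] := primitive_slope m_gt0 wE (gauss_range_lattice R1) le_e prim.
  right; rewrite jkE e0; exact: leq_ltn_trans (leq_subr _ _) (gauss_range_size R2).
by left; rewrite -em; exact: leq_ltn_trans (leq_subr _ _) (gauss_range_size R1).
Qed.

End Valuation.

(** * From the slope conditions to the Gauss range of [f] *)

Section Slopes.
Variables (K : fieldType) (G : orderedZmodType) (v : K -> option G).
Hypothesis hv : krull_valuation v.
Variables (H : divOrderedZmodType) (iota : {additive G -> H}).
Variables (f : {poly K}) (n j k : nat) (w : G).
Hypotheses (size_f : size f = n.+1) (vk : v f`_k = Some w).
Hypothesis cond : slope_conditions iota v f n j k.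

Let la := divg (iota w) (j%:Z - k%:Z).

Let lt_kj : (k < j)%N.
Proof. by case/andP: (slope_range cond) => /andP[_]; rewrite addn1. Qed.

Lemma edge_slopeM : la *+ (j - k) = iota w.
Proof.
have jk : j%:Z - k%:Z = (j - k)%N :> int by rewrite subzn // ltnW.
rewrite /la jk -[RHS](Defs.divgK (iota w) (j - k)%N) //.
by rewrite -lt0n subn_gt0.
Qed.

(** Clearing the denominator in (ii) or (iii) and adding [la *+ i] compares the point at [i] with
    the line of slope [-la] through (j, 0). Beyond degree n the value is infinity. *)
Lemma monval_above i : i != k -> i != j ->
  lto (Some (la *+ j)) (monval v iota la i f`_i).
Proof.
move=> neq_ik neq_ij; have [lt_ij|le_ji] := ltnP i j.
  have le_ij : (i <= j - 1)%N by rewrite leq_subRL ?(leq_ltn_trans _ lt_ij).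
  have := slope_left cond le_ij neq_ik.
  rewrite /slope /monval vk /=; case: (v _) => //= x.
  have ji : j%:Z - i%:Z = (j - i)%N :> int by rewrite subzn // ltnW.
  rewrite -/la /lto /= -!ltgNge ji => lt_la.
  have := ltg_addMn (j - i).-1 lt_la; rewrite prednK ?subn_gt0 //.
  have -> : divg (iota x) (j - i)%N *+ (j - i) = iota x.
    by rewrite -[RHS](Defs.divgK (iota x) (j - i)%N) // -lt0n subn_gt0.
  by rewrite -[X in _ -> la *+ X < _](subnK (ltnW lt_ij)) mulrnDr ltg_add2r.
have lt_ji : (j < i)%N by rewrite ltn_neqAle eq_sym neq_ij.
have [lt_ni|le_in] := ltnP n i.
  by rewrite nth_default ?size_f // monval0.
have := slope_right cond (leq_trans lt_ji le_in) (i := i).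
rewrite addn1 lt_ji le_in => /(_ isT).
rewrite /slope /monval vk /=; case: (v _) => //= x.
(* The denominator is negative here: with [y] the slope at [i], [iota x] is [- (y *+ (i - j))], so
   the upper bound [y < la] becomes a lower bound on [iota x]. *)
have ji : j%:Z - i%:Z = - (i - j)%N%:Z by rewrite -subzn // opprB.
rewrite -/la /lto /= -!ltgNge ji => lt_la.
have := ltg_addMn (i - j).-1 lt_la; rewrite prednK ?subn_gt0 //.
set y := divg _ _ => lt_y.
have -> : iota x = - (y *+ (i - j)).
  rewrite -[LHS](Defs.divgK (iota x) (- (i - j)%N%:Z)) -/y ?mulrNz //.
  by rewrite oppr_eq0 -lt0n subn_gt0.
rewrite -(ltg_add2r (y *+ (i - j))) addrAC addNr add0r.
by rewrite -[X in _ < _ *+ X](subnKC le_ji) mulrnDr ltg_add2l.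
Qed.

Lemma gauss_range_slope : gauss_range v iota la f (la *+ j) k j.
Proof.
have kE : monval v iota la k f`_k = Some (la *+ j).
  by rewrite /monval vk /= -edge_slopeM -mulrnDr subnK // ltnW.
have jE : monval v iota la j f`_j = Some (la *+ j).
  by rewrite /monval (slope_unit cond) /= raddf0 add0r.
split=> // [i|i lt_ik|i lt_ji].
- have [->|ik] := eqVneq i k; first by rewrite kE /=.
  have [->|ij] := eqVneq i j; first by rewrite jE /=.
  exact/ltoW/monval_above.
- by apply: monval_above; rewrite neq_ltn ?lt_ik // (ltn_trans lt_ik).
by apply: monval_above; rewrite neq_ltn ?lt_ji ?orbT // (ltn_trans lt_kj) ?orbT.
Qed.

End Slopes.

(* Condition (ii) forces v(a_k) to be finite, except when j = 1 and k = 0,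
   where it is vacuous. *)
Lemma slope_infty (K : fieldType) (G : orderedZmodType) (v : K -> option G)
    (H : divOrderedZmodType) (iota : {additive G -> H})
    (f : {poly K}) (n j k : nat) :
  slope_conditions iota v f n j k -> v f`_k = None -> j = 1%N.
Proof.
move=> cond vk; case: (slope_range cond) => /andP[/andP[_]]; rewrite addn1 => lt_kj _.
apply/eqP; rewrite eqn_leq (leq_ltn_trans (leq0n k) lt_kj) andbT leqNgt.
apply/negP => j_gt1.
(* The boolean [k == 0] read as a number is an index other than [k]: 1 if [k] is 0, and 0 otherwise.
   At it, (ii) would place infinity strictly below another slope. *)
have le_i : ((k == 0%N) <= j - 1)%N.
  by rewrite subn1 -ltnS prednK ?(ltnW j_gt1) //; case: eqP => // _; apply: ltnW.
have ne_i : (k == 0%N : nat) != k by case: (k).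
by have := slope_left cond le_i ne_i; rewrite /lto /slope vk.
Qed.

(** * Degree bounds for factorizations, and irreducibility *)

Theorem theorem1 (K : fieldType) (G : orderedZmodType) (v : K -> option G)
    (hv : krull_valuation v)
    (H : divOrderedZmodType) (iota : {additive G -> H})
    (iota_mono : {mono iota : x y / x <= y})
    (f : {poly K}) (n : nat) (size_f : size f = n.+1)
    (j k : nat)
    (hjk : smallest_indices (slope_conditions iota v f n) j k) :
  (forall f1 f2 : {poly K}, f = f1 * f2 ->
     ((size f1).-1 <= n - j + k)%N \/ ((size f2).-1 <= n - j + k)%N) /\
  (j = n -> k = 0%N -> irreducible_poly f).
Proof.
have {hjk} [cond _] := hjk.
have [lt_kj le_jn] : (k < j)%N /\ (j <= n)%N.
  by case/andP: (slope_range cond) => /andP[_]; rewrite addn1.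
have sizeM (f1 f2 : {poly K}) : f = f1 * f2 ->
  [/\ f1 != 0, f2 != 0 & ((size f1).-1 + (size f2).-1 = n)%N].
  move=> fE; have : f != 0 by rewrite -size_poly_gt0 size_f.
  rewrite fE mulf_eq0 negb_or => /andP[f10 f20]; split=> //.
  have := size_f; rewrite fE size_mul //.
  move: f10 f20; rewrite -!size_poly_gt0.
  by case: (size f1) (size f2) => [|a] [|b] // _ _; rewrite addSn addnS /= => -[].
have large (f1 f2 : {poly K}) : f = f1 * f2 ->
  (j - k <= (size f1).-1)%N \/ (j - k <= (size f2).-1)%N.
  move=> fE; case vk: (v f`_k) => [w|].
    have [||] := factor_degree hv iota_mono lt_kj
      (gauss_range_slope hv size_f vk cond) (edge_slopeM w cond) _ fE.
    - move=> d d_gt1 d_dvd [x wx]; apply: (slope_indivisible cond d_gt1 d_dvd).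
      by exists x; rewrite vk wx.
    - by case: (size f1) => // a lt_a; left.
    by case: (size f2) => // a lt_a; right.
  (* With [v(a_k)] infinite, j = 1 and k = 0, so it suffices that some factor has positive degree;
     this holds since n >= 1. *)
  have j1 := slope_infty cond vk.
  have [_ _] := sizeM _ _ fE; move: lt_kj le_jn; rewrite j1 ltnS leqn0 => /eqP->.
  by case: (size f1).-1 => [|a] n_gt0 sE; [right; rewrite -(add0n _.-1) sE | left].
have small (f1 f2 : {poly K}) : f = f1 * f2 ->
  ((size f1).-1 <= n - j + k)%N \/ ((size f2).-1 <= n - j + k)%N.
  (* The degrees add up to n, so the cofactor of a factor of degree at least [j - k] has degree at
     most [n - (j - k)]. *)
  have E : (n - j + k = n - (j - k))%N by rewrite subnBA ?addnBAC // ltnW.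
  move=> fE; have [_ _ nE] := sizeM _ _ fE; rewrite E -nE.
  case: (large _ _ fE) => le_m; [right | left].
    by rewrite leq_subRL ?(leq_trans le_m) ?leq_addr // leq_add2r.
  by rewrite leq_subRL ?(leq_trans le_m) ?leq_addl // addnC leq_add2l.
split=> // jn k0; split; first by rewrite size_f ltnS -jn (leq_ltn_trans _ lt_kj).
move=> q q_neq1 /dvdpP[p fE].
have [p0 q0 nE] := sizeM _ _ fE.
(* The bound is now 0, so one factor is constant: if it is the cofactor [p], then [q] is associate
   to [f]; a constant [q] is excluded by [q_neq1]. *)
have := small _ _ fE; rewrite jn k0 subnn !leqn0 => -[] /eqP s0.
  have p_const : size p == 1%N.
    by move: p0 s0; rewrite -size_poly_gt0; case: (size p) => [|[]].
  have /size_poly1P[c c0 pE] := p_const.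
  by rewrite fE pE mul_polyC eqp_sym eqp_scale.
by move: q0 q_neq1 s0; rewrite -size_poly_gt0; case: (size q) => [|[]].
Qed.
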